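(* Let $q\ge 1$ be arbitrary. Suppose there exists $\mathsf{K}^\star=\begin{bmatrix}0&C^\star_{\mathsf K}\\ B^\star_{\mathsf K}&A^\star_{\mathsf K}\end{bmatrix}\in\mathcal{C}_q$ such that $\nabla J_q(\mathsf{K}^\star)=0$. Then for any $q'\ge 1$ and any stable $\Lambda\in\mathbb{R}^{q'\times q'}$, the controller $$\tilde{\mathsf K}^\star=\begin{bmatrix}0&C^\star_{\mathsf K}&0\\ B^\star_{\mathsf K}&A^\star_{\mathsf K}&0\\ 0&0&\Lambda\end{bmatrix}\in\mathcal{C}_{q+q'}$$ (i.e. the controller of order $q+q'$ with state matrix $\begin{bmatrix}A^\star_{\mathsf K}&0\\ 0&\Lambda\end{bmatrix}$, input matrix $\begin{bmatrix}B^\star_{\mathsf K}\\ 0\end{bmatrix}$ and output matrix $\begin{bmatrix}C^\star_{\mathsf K}&0\end{bmatrix}$) is a stationary point of $J_{q+q'}$ over $\mathcal{C}_{q+q'}$ satisfying $J_{q+q'}(\tilde{\mathsf K}^\star)=J_q(\mathsf K^\star)$.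
   Context: Fix integers $n,m,p\ge 1$, real matrices $A\in\mathbb{R}^{n\times n}$, $B\in\mathbb{R}^{n\times m}$, $C\in\mathbb{R}^{p\times n}$ (the plant $\dot x=Ax+Bu+w$, $y=Cx+v$, with $w,v$ white Gaussian noises of intensities $W,V$), and real symmetric matrices $W\succeq 0$ ($n\times n$), $V\succ 0$ ($p\times p$), $Q\succeq 0$ ($n\times n$), $R\succ 0$ ($m\times m$). Standing assumption: $(A,B)$ and $(A,W^{1/2})$ are controllable, and $(C,A)$ and $(Q^{1/2},A)$ are observable. A real square matrix is called stable if all its eigenvalues have negative real part. For $q\ge1$, $\mathcal{V}_q$ is the linear space of matrices $\begin{bmatrix}0_{m\times p}&C_{\mathsf K}\\ B_{\mathsf K}&A_{\mathsf K}\end{bmatrix}\in\mathbb{R}^{(m+q)\times(p+q)}$ with $A_{\mathsf K}\in\mathbb{R}^{q\times q}$, $B_{\mathsf K}\in\mathbb{R}^{q\times p}$, $C_{\mathsf K}\in\mathbb{R}^{m\times q}$, and $\mathcal{C}_q\subseteq\mathcal{V}_q$ is the (open) subset of those $\mathsf K$ for which $A_{\mathrm{cl},\mathsf K}=\begin{bmatrix}A&BC_{\mathsf K}\\ B_{\mathsf K}C&A_{\mathsf K}\end{bmatrix}$ is stable. Such a $\mathsf K$ represents the dynamical controller $\dot\xi=A_{\mathsf K}\xi+B_{\mathsf K}y$, $u=C_{\mathsf K}\xi$. $J_q:\mathcal{C}_q\to\mathbb{R}$ is the resulting LQG cost $\lim_{T\to\infty}\frac1T\mathbb{E}\int_0^T(x^{\mathsf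 T}Qx+u^{\mathsf T}Ru)\,dt$, equivalently $$J_q(\mathsf K)=\operatorname{tr}\left(\begin{bmatrix}Q&0\\ 0&C_{\mathsf K}^{\mathsf T}RC_{\mathsf K}\end{bmatrix}X_{\mathsf K}\right),\qquad A_{\mathrm{cl},\mathsf K}X_{\mathsf K}+X_{\mathsf K}A_{\mathrm{cl},\mathsf K}^{\mathsf T}+\begin{bmatrix}W&0\\ 0&B_{\mathsf K}VB_{\mathsf K}^{\mathsf T}\end{bmatrix}=0,$$ where $X_{\mathsf K}$ is the unique solution. $J_q$ is real analytic on $\mathcal{C}_q$; $\nabla J_q$ is its gradient in $\mathcal{V}_q$ with respect to the inner product $\operatorname{tr}(U^{\mathsf T}\Delta)$; a stationary point is a point where the gradient vanishes. *)

(* Defs.v *)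
From HB Require Import structures.
From mathcomp Require Import all_boot all_order all_algebra.
From mathcomp Require Import all_classical all_reals all_analysis.
From mathcomp Require Import complex.

Set Implicit Arguments.
Unset Strict Implicit.
Unset Printing Implicit Defensive.

Import Order.TTheory GRing.Theory Num.Theory.
Import numFieldNormedType.Exports.

Local Open Scope classical_set_scope.
Local Open Scope ring_scope.

Definition psdmx (R : realType) (n : nat) (M : 'M[R]_n) : Prop :=
  M^T = M /\ forall x : 'cV[R]_n, 0 <= (x^T *m M *m x) 0 0.

Definition pdmx (R : realType) (n : nat) (M : 'M[R]_n) : Prop :=
  M^T = M /\ forall x : 'cV[R]_n, x != 0 -> 0 < (x^T *m M *m x) 0 0.

(* The unique positive semidefinite square root of a positive semidefinite
   matrix; the default value 0 is irrelevant in that case. *)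
Definition sqrtmx (R : realType) (n : nat) (M : 'M[R]_n) : 'M[R]_n :=
  xget 0 [set S : 'M[R]_n | psdmx S /\ S *m S = M].

(* Eigenvalues are taken in the complex numbers R[i].  [eigenvalue] is the
   library notion (left eigenvectors), which has the same eigenvalues. *)
Definition is_stable (R : realType) (n : nat) (M : 'M[R]_n) : Prop :=
  forall z : R[i], eigenvalue (map_mx (real_complex R) M) z ->
    complex.Re z < 0.

Definition is_trajectory (R : realType) (n m : nat) (A : 'M[R]_n)
    (B : 'M[R]_(n, m)) (u : R -> 'cV[R]_m) (x : R -> 'cV[R]_n) : Prop :=
  forall t : R, is_derive t (1 : R) x (A *m x t + B *m u t).

Definition controllable (R : realType) (n m : nat) (A : 'M[R]_n)
    (B : 'M[R]_(n, m)) : Prop :=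
  forall (T : R) (x0 x1 : 'cV[R]_n), 0 < T ->
    exists (u : R -> 'cV[R]_m) (x : R -> 'cV[R]_n),
      [/\ continuous u, is_trajectory A B u x, x 0 = x0 & x T = x1].

(* By linearity it suffices to distinguish states under zero input. *)
Definition observable (R : realType) (n p : nat) (C : 'M[R]_(p, n))
    (A : 'M[R]_n) : Prop :=
  forall (T : R) (x x' : R -> 'cV[R]_n), 0 < T ->
    (forall t : R, is_derive t (1 : R) x (A *m x t)) ->
    (forall t : R, is_derive t (1 : R) x' (A *m x' t)) ->
    (forall t : R, 0 <= t <= T -> C *m x t = C *m x' t) ->
    x 0 = x' 0.

Definition ctrl_mx (R : realType) (m p q : nat) (AK : 'M[R]_q)
    (BK : 'M[R]_(q, p)) (CK : 'M[R]_(m, q)) : 'M[R]_(m + q, p + q) :=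
  block_mx 0 CK BK AK.

Definition ctrl_space (R : realType) (m p q : nat) :
    set 'M[R]_(m + q, p + q) :=
  [set K | exists AK BK CK, K = ctrl_mx AK BK CK].

Definition ctrlA (R : realType) (m p q : nat) (K : 'M[R]_(m + q, p + q)) :
  'M[R]_q := drsubmx K.

Definition ctrlB (R : realType) (m p q : nat) (K : 'M[R]_(m + q, p + q)) :
  'M[R]_(q, p) := dlsubmx K.

Definition ctrlC (R : realType) (m p q : nat) (K : 'M[R]_(m + q, p + q)) :
  'M[R]_(m, q) := ursubmx K.

Definition closed_loop (R : realType) (n m p q : nat) (A : 'M[R]_n)
    (B : 'M[R]_(n, m)) (C : 'M[R]_(p, n)) (K : 'M[R]_(m + q, p + q)) :
    'M[R]_(n + q) :=
  block_mx A (B *m ctrlC K) (ctrlB K *m C) (ctrlA K).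

Definition stabilizing (R : realType) (n m p q : nat) (A : 'M[R]_n)
    (B : 'M[R]_(n, m)) (C : 'M[R]_(p, n)) : set 'M[R]_(m + q, p + q) :=
  [set K | ctrl_space K /\ is_stable (closed_loop A B C K)].

Definition lyapunov_eq (R : realType) (n m p q : nat) (A : 'M[R]_n)
    (B : 'M[R]_(n, m)) (C : 'M[R]_(p, n)) (W : 'M[R]_n) (V : 'M[R]_p)
    (K : 'M[R]_(m + q, p + q)) (X : 'M[R]_(n + q)) : Prop :=
  closed_loop A B C K *m X + X *m (closed_loop A B C K)^T
    + block_mx W 0 0 (ctrlB K *m V *m (ctrlB K)^T) = 0.

(* For K in [stabilizing A B C] the Lyapunov equation has exactly one
   solution, so that the default value 0 plays no role. *)
Definition lyapunov_sol (R : realType) (n m p q : nat) (A : 'M[R]_n)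
    (B : 'M[R]_(n, m)) (C : 'M[R]_(p, n)) (W : 'M[R]_n) (V : 'M[R]_p)
    (K : 'M[R]_(m + q, p + q)) : 'M[R]_(n + q) :=
  xget 0 [set X | lyapunov_eq A B C W V K X].

(* Meaningful on [stabilizing A B C] only. *)
Definition lqg_cost (R : realType) (n m p q : nat) (A : 'M[R]_n)
    (B : 'M[R]_(n, m)) (C : 'M[R]_(p, n)) (W : 'M[R]_n) (V : 'M[R]_p)
    (Q : 'M[R]_n) (Rw : 'M[R]_m) (K : 'M[R]_(m + q, p + q)) : R :=
  \tr (block_mx Q 0 0 ((ctrlC K)^T *m Rw *m ctrlC K)
         *m lyapunov_sol A B C W V K).

(* G is the gradient at K, in the space [ctrl_space] with the inner product
   tr (U^T D), of a function J on the subset S, which is meant to be open in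
   [ctrl_space].  Only values of J on S are used; as all norms on matrices are
   equivalent, the library's max norm may be used. *)
Definition is_gradient (R : realType) (m p q : nat)
    (S : set 'M[R]_(m + q, p + q)) (J : 'M[R]_(m + q, p + q) -> R)
    (K G : 'M[R]_(m + q, p + q)) : Prop :=
  ctrl_space G /\
  (J K' - J K - \tr (G^T *m (K' - K))) / `|K' - K|
    @[K' --> within S K^'] --> (0 : R).

(* Main.v *)
(* The cost at a nearby controller is compared with the cost at [K] by duality.
   Let [a] be the closed loop matrix, [s] the weight, [X] the Gramian, and [Y]
   the solution of the adjoint equation [a^T Y + Y a + s = 0].  The identity
   [tr (s X') = - tr (Y (a X' + X' a^T))] gives the derivative of the cost in
   direction [D] explicitly in terms of [K], [X], [Y] and [D], with a remainder
   quadratic in [D].  Stability is an open condition, hence stationarity means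
   that this expression vanishes for every [D].

   Let [E] be the projection that forgets the coordinates of [L].  The Gramian
   and the adjoint solution of the augmented controller are [E^T X E] and
   [E^T Y E], so that its derivative in direction [D'] is the derivative of the
   original cost in the compressed direction [E D' E^T], which is zero. *)

Require Import Defs.
From HB Require Import structures.
From mathcomp Require Import all_boot all_order all_algebra.
From mathcomp Require Import all_classical all_reals all_analysis.
From mathcomp Require Import complex ring lra.

Set Implicit Arguments.
Unset Strict Implicit.
Unset Printing Implicit Defensive.

Import Order.TTheory GRing.Theory Num.Theory.
Import numFieldNormedType.Exports.

Local Open Scope classical_set_scope.
Local Open Scope ring_scope.

(** * Estimates in the max norm of matrices *)

Lemma mx_coef_norm_le (K : numFieldType) (m n : nat) (M : 'M[K]_(m, n)) i j :
  `|M i j| <= `|M|.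
Proof.
have : `|M| <= `|M| by [].
rewrite {1 2}/Num.norm /= !mx_normE num_le => /bigmax_leP[_ /(_ (i, j) isT)].
by rewrite -num_le.
Qed.

Lemma mx_norm_le_coef (K : numFieldType) (m n : nat) (M : 'M[K]_(m, n)) e :
  0 <= e -> (forall i j, `|M i j| <= e) -> `|M| <= e.
Proof.
move=> e0 Me; rewrite /Num.norm /=; have [->//|] := eqVneq (mx_norm M) 0.
by move/mx_norm_neq0 => [ij ->].
Qed.

(** Each entry of the product is a sum of [n] products of entries, whence the factor [n]: the max
    norm alone is not submultiplicative. *)
Lemma mulmx_norm_le (K : numFieldType) (m n r : nat)
    (M : 'M[K]_(m, n)) (N : 'M[K]_(n, r)) :
  `|M *m N| <= n%:R * `|M| * `|N|.
Proof.
apply: mx_norm_le_coef => [|i j]; first by rewrite !mulr_ge0.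
rewrite mxE (le_trans (ler_norm_sum _ _ _))//.
rewrite -mulrA mulr_natl -[n in _ *+ n]card_ord -sumr_const ler_sum// => k _.
by rewrite normrM ler_pM// mx_coef_norm_le.
Qed.

Lemma map_real_complex_norm (R : rcfType) (m n : nat) (M : 'M[R]_(m, n)) :
  `|map_mx (real_complex R) M| <= `|M|%:C%C.
Proof.
apply: mx_norm_le_coef => [|i j]; first by rewrite lecR.
by rewrite mxE /= normc_def /= expr0n addr0 sqrtr_sqr lecR mx_coef_norm_le.
Qed.

(** * Stable matrices: Sylvester equations and openness *)

Local Notation toC := (map_mx (real_complex _)).

(** Cayley-Hamilton, with the characteristic polynomial split over [R[i]]; its roots are the
    eigenvalues. The size [n.+1] gives square matrices their ring structure. *)
Lemma stable_annihilator (R : realType) (n : nat) (M : 'M[R]_n.+1) :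
  is_stable M -> exists s : seq R[i],
    (forall z, z \in s -> complex.Re z < 0) /\
    \prod_(z <- s) (toC M - z%:M) = 0.
Proof.
move=> stM; have [s ps] := closed_field_poly_normal (char_poly (toC M)).
move: ps; rewrite (monicP (char_poly_monic _)) scale1r => ps.
exists s; split=> [z zs|].
  by apply: stM; rewrite eigenvalue_root_char ps root_prod_XsubC.
have := Cayley_Hamilton (toC M); rewrite ps rmorph_prod => <-.
apply: eq_bigr => z _.
by rewrite rmorphB /= horner_mx_X horner_mx_C.
Qed.

Lemma stable_trmx (R : realType) (n : nat) (M : 'M[R]_n) :
  is_stable M -> is_stable M^T.
Proof.
move=> stM z; rewrite eigenvalue_root_char => rz; apply: stM.
rewrite eigenvalue_root_char; congr (root _ z): rz.
rewrite /char_poly -[RHS]det_tr; congr (\det _).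
by apply/matrixP => i j; rewrite !mxE eq_sym.
Qed.

(** From [X N = (- M) X], each factor of a polynomial in [N] crosses [X] and becomes the same factor
    in [- M]. *)
Lemma intertwine_annihilator (K : fieldType) (n m : nat) (M : 'M[K]_m.+1)
    (N : 'M[K]_n.+1) (X : 'M[K]_(m.+1, n.+1)) (s : seq K) :
  M *m X + X *m N = 0 ->
  X *m \prod_(z <- s) (N - z%:M) = \prod_(z <- s) (- M - z%:M) *m X.
Proof.
move=> eqX; elim: s => [|z s IHs].
  by rewrite !big_nil mulmx1 mul1mx.
rewrite !big_cons; have -> : X *m ((N - z%:M) * \prod_(j <- s) (N - j%:M)) =
  (- M - z%:M) *m X *m \prod_(j <- s) (N - j%:M).
  rewrite mulmxA; congr (_ *m _).
  rewrite mulmxBr mulmxBl mul_mx_scalar mul_scalar_mx; congr (_ - _).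
  by apply/eqP; rewrite -subr_eq0 mulNmx opprK addrC eqX.
by rewrite -mulmxA IHs mulmxA.
Qed.

(* The spectra of [M] and [- N] are disjoint: a polynomial annihilating [N] is
   invertible at [- M]. *)
Lemma sylvester_inj (R : realType) (n m : nat) (M : 'M[R]_m) (N : 'M[R]_n)
    (X : 'M[R]_(m, n)) :
  is_stable M -> is_stable N -> M *m X + X *m N = 0 -> X = 0.
Proof.
case: n => [|n] in N X *; first by move=> _ _ _; rewrite thinmx0.
case: m => [|m] in M X *; first by move=> _ _ _; rewrite flatmx0.
move=> stM /stable_annihilator[s [s_neg sN]] eqX.
have eqXC : toC M *m toC X + toC X *m toC N = 0.
  by rewrite -!map_mxM -map_mxD eqX map_mx0.
have := intertwine_annihilator s eqXC.
rewrite sN mulmx0 => /esym eq0.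
(* A singular factor would make [- z] an eigenvalue of [M]; but [z] and all eigenvalues of [M] have
   negative real parts. *)
have PU : \prod_(z <- s) (- toC M - z%:M) \is a GRing.unit.
  rewrite big_seq; apply: rpred_prod => z zs.
  rewrite -unitrN opprB opprK addrC.
  apply: contraT => nU.
  have : eigenvalue (toC M) (- z).
    apply: contraNT nU; rewrite negbK => /eqP.
    rewrite /eigenspace => /eqP; rewrite kermx_eq0 row_free_unit.
    by rewrite raddfN /= opprK.
  by move/stM; rewrite raddfN /= oppr_lt0 => /ltW; rewrite leNgt s_neg.
have : toC X = 0 by apply: (can_inj (mulKmx PU)); rewrite mulmx0.
by move/eqP; rewrite map_mx_eq0 => /eqP.
Qed.

Lemma mxvec_norm (K : numFieldType) (m n : nat) (M : 'M[K]_(m, n)) :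
  `|mxvec M| = `|M|.
Proof.
apply: le_anti; rewrite !mx_norm_le_coef// => i j.
  by rewrite -mxvecE mx_coef_norm_le.
rewrite (ord1 i); case/mxvec_indexP: j => i' j'.
by rewrite mxvecE mx_coef_norm_le.
Qed.

(** On vectorized matrices [f] is multiplication by [lin_mx f], and vectorization preserves the max
    norm. *)
Lemma linear_bound (K : numFieldType) (m n r t : nat)
    (f : {linear 'M[K]_(m, n) -> 'M[K]_(r, t)}) :
  exists2 k : K, 0 <= k & forall D, `|f D| <= k * `|D|.
Proof.
exists ((m * n)%:R * `|lin_mx f|) => [|D]; first by rewrite mulr_ge0.
rewrite -mxvec_norm -mul_vec_lin -[leRHS]mulrA [X in _ * X]mulrC mulrA.
by rewrite -(mxvec_norm D) mulmx_norm_le.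
Qed.

(** The Sylvester operator is an injective endomorphism of a finite-dimensional space, hence
    invertible; [c] comes from the norm of its inverse and so does not depend on [Z]. *)
Lemma sylvester_solve (R : realType) (n m : nat) (M : 'M[R]_m) (N : 'M[R]_n) :
  is_stable M -> is_stable N -> exists2 c : R, 0 <= c &
    forall Z : 'M[R]_(m, n), exists2 X, M *m X + X *m N = Z & `|X| <= c * `|Z|.
Proof.
move=> stM stN; pose f (X : 'M[R]_(m, n)) := M *m X + X *m N.
have f_lin : linear f.
  move=> k X Y; rewrite /f mulmxDr mulmxDl -scalemxAr -scalemxAl scalerDr.
  by rewrite addrACA.
pose fL : {linear 'M[R]_(m, n) -> 'M[R]_(m, n)} :=
  HB.pack f (GRing.isLinear.Build _ _ _ _ f f_lin).
have FU : lin_mx fL \in unitmx.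
  rewrite -row_free_unit; apply: inj_row_free => v.
  rewrite mul_rV_lin => /eqP; rewrite mxvec_eq0.
  move=> /eqP /(sylvester_inj stM stN).
  by move/eqP; rewrite vec_mx_eq0 => /eqP.
exists ((m * n)%:R * `|invmx (lin_mx fL)|); first by rewrite mulr_ge0.
move=> Z; exists (vec_mx (mxvec Z *m invmx (lin_mx fL))).
  by rewrite -[LHS]/(fL _) -mx_rV_lin mulmxKV// mxvecK.
rewrite -[leLHS]mxvec_norm vec_mxK (le_trans (mulmx_norm_le _ _))//.
by rewrite mxvec_norm mulrAC.
Qed.

Lemma sylvester_bound (R : realType) (n m : nat) (M : 'M[R]_m) (N : 'M[R]_n) :
  is_stable M -> is_stable N -> exists2 c : R, 0 <= c &
    forall X : 'M[R]_(m, n), `|X| <= c * `|M *m X + X *m N|.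
Proof.
move=> stM stN; have [c c0 cP] := sylvester_solve stM stN.
exists c => // X; have [X0 eqX0 X0b] := cP (M *m X + X *m N).
suff -> : X = X0 by rewrite eqX0.
apply/eqP; rewrite -subr_eq0; apply/eqP; apply: (sylvester_inj stM stN).
by rewrite mulmxBr mulmxBl addrACA -opprD eqX0 subrr.
Qed.

(* When the product of the [M - w] vanishes, this bounds [\prod (z - w)] by
   [c * `|E|]: the eigenvalue [z] of [M + E] is close to one of the [w]. *)
Lemma perturbed_eigenvector_prod (K : numFieldType) (n : nat) (M : 'M[K]_n.+1)
    (b : K) (s : seq K) :
  0 <= b -> exists2 c : K, 0 <= c &
    forall (E : 'M[K]_n.+1) (v : 'rV[K]_n.+1) (z : K), `|z| <= b ->
      v *m (M + E) = z *: v ->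
      `|v *m \prod_(w <- s) (M - w%:M) - (\prod_(w <- s) (z - w)) *: v|
        <= c * `|E| * `|v|.
Proof.
move=> b0; elim: s => [|w s [c c0 IHs]].
  exists 0 => // E v z _ _.
  by rewrite !big_nil mulmx1 scale1r subrr normr0 !mul0r.
set P := \prod_(w <- s) (M - w%:M) in IHs *.
(* The factor [z - w] has modulus at most [b + |w|]; the two matrix products in [v E P] contribute
   [n.+1] each. *)
exists ((b + `|w|) * c + n.+1%:R * n.+1%:R * `|P|).
  by rewrite addr_ge0 ?mulr_ge0 ?addr_ge0.
move=> E v z zb eqv; have := IHs E v z zb eqv.
rewrite !big_cons -/P; set r := \prod_(w <- s) _ => IH.
(* Since [v M = z v - v E], one more factor multiplies the previous error by [z - w] and creates the
   new error [v E P]. *)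
have -> : v *m ((M - w%:M) * P) - ((z - w) * r) *: v =
    (z - w) *: (v *m P - r *: v) - v *m E *m P.
  have -> : v *m ((M - w%:M) * P) = v *m (M - w%:M) *m P by rewrite mulmxA.
  have -> : v *m (M - w%:M) = (z - w) *: v - v *m E.
    by rewrite mulmxBr mul_mx_scalar scalerBl -eqv mulmxDr addrAC addrK.
  by rewrite mulmxBl -scalemxAl scalerBr scalerA addrAC.
rewrite (le_trans (ler_normB _ _))// -mulrA mulrDl lerD//.
  rewrite mx_normZ -mulrA ler_pM//; last by rewrite mulrA.
  by rewrite (le_trans (ler_normB _ _))// lerD2r.
rewrite (le_trans (mulmx_norm_le _ _))//.
rewrite [leRHS](_ : _ = n.+1%:R * (n.+1%:R * `|v| * `|E|) * `|P|); last by ring.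
by rewrite ler_wpM2r// ler_wpM2l// mulmx_norm_le.
Qed.

(** If [M'] had an eigenvalue [z] with nonnegative real part, then [|z - w|] would be at least
    [- Re w] for every [w] in [s], and the product of these distances at least [r > 0]. That product
    is at most [c |M' - M|], which is too small near [M]. *)
Lemma stable_open (R : realType) (n : nat) (M : 'M[R]_n) :
  is_stable M -> exists2 d : R, 0 < d &
    forall M' : 'M[R]_n, `|M' - M| < d -> is_stable M'.
Proof.
case: n => [|n] in M *.
  by move=> stM; exists 1 => [//|M' _]; rewrite (_ : M' = M)// !thinmx0.
move=> /stable_annihilator[s [s_neg sM]].
(* [b] bounds all eigenvalues of the matrices within distance 1 of [M]. *)
pose b : R[i] := n.+1%:R * (`|toC M| + 1).
have b0 : 0 <= b by rewrite mulr_ge0 ?addr_ge0.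
have [c c0 cP] := perturbed_eigenvector_prod (toC M) s b0.
pose r : R := \prod_(w <- s) - complex.Re w.
have r0 : 0 < r.
  by rewrite /r big_seq; apply: prodr_gt0 => w ws; rewrite oppr_gt0 s_neg.
(* A nonnegative element of [R[i]] is real, so [k] is [c] itself, read in [R]. *)
pose k : R := complex.Re c.
have k0 : 0 <= k by rewrite -lecR RRe_real ?ger0_real.
have ck : c = k%:C%C by rewrite RRe_real ?ger0_real.
exists (Num.min 1 (r / (k + 1))).
  by rewrite lt_min ltr01 divr_gt0// ltr_wpDl.
move=> M'; rewrite lt_min => /andP[d1 d2] z /eigenvalueP[v eqv v0].
rewrite ltNge; apply/negP => z0.
pose E := toC (M' - M).
have EM : `|E| <= `|M' - M|%:C%C := map_real_complex_norm _.
have eqM : toC M' = toC M + E by rewrite /E map_mxB addrC subrK.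
have nv0 : 0 < `|v| by rewrite normr_gt0.
have zb : `|z| <= b.
  rewrite -(ler_pM2r nv0) -mx_normZ -eqv eqM.
  rewrite (le_trans (mulmx_norm_le _ _))// mulrAC.
  rewrite /b ler_wpM2r// ler_wpM2l//.
  rewrite (le_trans (ler_normD _ _))// lerD2l (le_trans EM)//.
  by rewrite -[1]/(1%:C%C) lecR ltW.
have := cP E v z zb; rewrite -eqM => /(_ eqv).
rewrite sM mulmx0 sub0r normrN mx_normZ ler_pM2r//.
have rz : r%:C%C <= `|\prod_(w <- s) (z - w)|.
  rewrite normr_prod rmorph_prod /= big_seq [leRHS]big_seq.
  apply: ler_prod => w ws; rewrite lecR oppr_ge0 ltW ?s_neg//=.
  apply: le_trans (normc_ge_Re _); rewrite raddfB /= lecR.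
  by rewrite (le_trans _ (ler_norm _))// lerDr.
move=> /(le_trans rz); apply/negP; rewrite lt_geF//.
apply: (@le_lt_trans _ _ (c * `|M' - M|%:C%C)); first by rewrite ler_wpM2l.
rewrite ck -rmorphM ltcR (@le_lt_trans _ _ ((k + 1) * `|M' - M|))//.
  by rewrite ler_wpM2r// lerDl.
by rewrite mulrC -ltr_pdivlMr// ltr_wpDl.
Qed.

(** * Bounds for bilinear expressions and their traces *)

Lemma bilinear_bound (K : numFieldType) (m n m' n' r t u : nat)
    (f : {linear 'M[K]_(m, n) -> 'M[K]_(r, t)})
    (g : {linear 'M[K]_(m', n') -> 'M[K]_(t, u)}) :
  exists2 k : K, 0 <= k & forall D E, `|f D *m g E| <= k * `|D| * `|E|.
Proof.
have [k k0 kP] := linear_bound f; have [l l0 lP] := linear_bound g.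
exists (t%:R * k * l) => [|D E]; first by rewrite !mulr_ge0.
rewrite (le_trans (mulmx_norm_le _ _))// -!mulrA ler_wpM2l//.
rewrite [leRHS](_ : _ = (k * `|D|) * (l * `|E|)); last by ring.
by rewrite ler_pM.
Qed.

Lemma mxtrace_norm_le (K : numFieldType) (n : nat) (M : 'M[K]_n) :
  `|\tr M| <= n%:R * `|M|.
Proof.
rewrite (le_trans (ler_norm_sum _ _ _))//.
rewrite mulr_natl -[n in _ *+ n]card_ord -sumr_const ler_sum// => i _.
exact: mx_coef_norm_le.
Qed.

Lemma mxtrace_bilinear_bound (K : numFieldType) (m n m' n' r t : nat)
    (f : {linear 'M[K]_(m, n) -> 'M[K]_(r, t)})
    (g : {linear 'M[K]_(m', n') -> 'M[K]_(t, r)}) :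
  exists2 k : K, 0 <= k & forall D E, `|\tr (f D *m g E)| <= k * `|D| * `|E|.
Proof.
have [k k0 kP] := bilinear_bound f g.
exists (r%:R * k) => [|D E]; first by rewrite mulr_ge0.
by rewrite (le_trans (mxtrace_norm_le _))// -!mulrA ler_wpM2l// mulrA.
Qed.

(** * Second-order expansion of the cost under static output feedback *)

(* The matrices of the closed loop in static output feedback form, affine or
   quadratic in the block matrix [K] of the controller. *)
Section StaticFeedback.
Variables (R : realType) (N r c : nat).
Variables (A0 : 'M[R]_N) (B0 : 'M[R]_(N, r)) (C0 : 'M[R]_(c, N)).
Variables (W0 : 'M[R]_N) (J1 : 'M[R]_(N, r)) (V0 : 'M[R]_c).
Variables (Q0 : 'M[R]_N) (J2 : 'M[R]_(N, c)) (R0 : 'M[R]_r).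
Implicit Types (K D : 'M[R]_(r, c)) (X Y : 'M[R]_N).

Definition sf_state K := A0 + B0 *m K *m C0.
Definition sf_noise K := W0 + J1 *m (K *m V0 *m K^T) *m J1^T.
Definition sf_weight K := Q0 + J2 *m (K^T *m R0 *m K) *m J2^T.

(* The derivative of [K |-> \tr (sf_weight K *m X K)] in direction [D], where
   [X] is the Gramian at [K] and [Y] solves the adjoint Lyapunov equation. *)
Definition sf_dcost K X Y D : R :=
  \tr (J2 *m (D^T *m R0 *m K + K^T *m R0 *m D) *m J2^T *m X)
  + \tr (Y *m (J1 *m (D *m V0 *m K^T + K *m V0 *m D^T) *m J1^T))
  + \tr (Y *m (B0 *m D *m C0 *m X + X *m (B0 *m D *m C0)^T)).

Lemma sf_dcostZ K X Y t D : sf_dcost K X Y (t *: D) = t * sf_dcost K X Y D.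
Proof.
rewrite /sf_dcost !mulrDr -!mxtraceZ; congr (_ + _ + _); congr (\tr _).
- by rewrite linearZ /= -!(scalemxAl, scalemxAr, scalerDr).
- by rewrite linearZ /= -!(scalemxAl, scalemxAr, scalerDr).
- rewrite -!(scalemxAl, scalemxAr) linearZ /=.
  by rewrite -!(scalemxAl, scalemxAr, scalerDr).
Qed.

Lemma lyapunov_duality (a s X Y : 'M[R]_N) :
  a^T *m Y + Y *m a + s = 0 ->
  \tr (s *m X) = - \tr (Y *m (a *m X + X *m a^T)).
Proof.
move=> eqY; have -> : s = - (a^T *m Y + Y *m a).
  by apply/eqP; rewrite -addr_eq0 addrC eqY.
rewrite mulNmx raddfN mulmxDl mulmxDr !raddfD /= -mulmxA mxtrace_mulC -!mulmxA.
by rewrite addrC.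
Qed.

(** Duality with the one solution [Y] at [K] rewrites both [X] and [X'] through their Lyapunov
    equations. Once the part linear in [D] is removed, every remaining term has at least two small
    factors among [D], [T] and [X' - X]. *)
Lemma sf_cost_remainder K X Y K' X' (D := K' - K) (T := B0 *m D *m C0) :
  sf_state K *m X + X *m (sf_state K)^T + sf_noise K = 0 ->
  (sf_state K)^T *m Y + Y *m sf_state K + sf_weight K = 0 ->
  sf_state K' *m X' + X' *m (sf_state K')^T + sf_noise K' = 0 ->
  \tr (sf_weight K' *m X') - \tr (sf_weight K *m X) - sf_dcost K X Y D =
    \tr (J2 *m (D^T *m R0 *m K + K^T *m R0 *m D) *m J2^T *m (X' - X))
    + \tr (J2 *m D^T *m R0 *m (D *m J2^T *m X))
    + \tr (J2 *m (D^T *m R0 *m D) *m J2^T *m (X' - X))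
    + \tr (Y *m J1 *m D *m V0 *m (D^T *m J1^T))
    + \tr (Y *m T *m (X' - X)) + \tr (Y *m (X' - X) *m T^T).
Proof.
move=> eqX eqY eqX'.
have dX := lyapunov_duality X eqY; have dX' := lyapunov_duality X' eqY.
have eK' : K' = K + D by rewrite /D addrC subrK.
have eX : sf_state K *m X + X *m (sf_state K)^T = - sf_noise K.
  by apply/eqP; rewrite -addr_eq0 eqX.
(* The equation of [X'] is read as an equation for the state matrix at [K], with the perturbation
   [T] moved to the right. *)
have eX' : sf_state K *m X' + X' *m (sf_state K)^T =
    - (sf_noise K' + T *m X' + X' *m T^T).
  apply/eqP; rewrite -addr_eq0 -[X in _ == X]eqX'.
  have -> : sf_state K' = sf_state K + T.
    by rewrite /sf_state eK' mulmxDr mulmxDl addrA.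
  move: (sf_state K) => a; rewrite linearD /= mulmxDl mulmxDr.
  by apply/eqP; rewrite (AC (2*3) ((1*4)*(2*5)*3)).
(* The change of weight is split off so that duality at [K] applies to [X']. *)
have -> : \tr (sf_weight K' *m X') = \tr (sf_weight K *m X') +
    \tr (J2 *m (K'^T *m R0 *m K' - K^T *m R0 *m K) *m J2^T *m X').
  rewrite -raddfD -mulmxDl; congr (\tr _); congr (_ *m _).
  rewrite /sf_weight mulmxBr mulmxBl -addrA; congr (_ + _).
  by rewrite addrC subrK.
rewrite dX dX' eX eX' /sf_dcost /sf_noise -/T.
have trN (M : 'M[R]_N) : \tr (- M) = - \tr M by rewrite raddfN.
clearbody T D; subst K'; rewrite [(K + D)^T]linearD /=.
rewrite !(mulmxDl, mulmxDr, mulmxN, mulNmx).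
rewrite !(mxtraceD, trN).
rewrite !mulmxA.
ring.
Qed.

(** The Sylvester bound at [K] gives [|X' - X| <= al |D| + be |D| |X' - X|], because [|X'|] is at
    most [|X| + |X' - X|]. For [be |D| <= 1/2] the last term is absorbed on the left, which doubles
    [al]. *)
Lemma sf_gramian_lipschitz K X :
  is_stable (sf_state K) ->
  sf_state K *m X + X *m (sf_state K)^T + sf_noise K = 0 ->
  exists g d : R, [/\ 0 <= g, 0 < d & forall K' X', `|K' - K| < d ->
    sf_state K' *m X' + X' *m (sf_state K')^T + sf_noise K' = 0 ->
    `|X' - X| <= g * `|K' - K|].
Proof.
move=> stK eqX.
have [s s0 sP] := sylvester_bound stK (stable_trmx stK).
have [k1 k10 k1P] := bilinear_bound (mulmxr C0 \o mulmx B0) (@idfun 'M[R]_N).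
have [k2 k20 k2P] := bilinear_bound (@idfun 'M[R]_N)
  (trmx \o (mulmxr C0 \o mulmx B0)).
have [k3 k30 k3P] := linear_bound
  ((mulmxr (K^T *m J1^T) \o mulmxr V0 \o mulmx J1) \+
   (mulmx (J1 *m K *m V0) \o mulmxr J1^T \o trmx)).
have [k4 k40 k4P] := bilinear_bound
  (mulmxr V0 \o mulmx J1) (mulmxr J1^T \o trmx).
pose al := s * (k3 + k4 + (k1 + k2) * `|X|).
have [be beE] : exists be, be = s * (k1 + k2) by eexists.
have al0 : 0 <= al by rewrite !(mulr_ge0, addr_ge0).
have be0 : 0 <= be by rewrite beE !(mulr_ge0, addr_ge0).
have be1 : 0 < 2 * be + 1 by rewrite ltr_wpDl// mulr_ge0.
exists (2 * al), (Num.min 1 (2 * be + 1)^-1); split; first by rewrite mulr_ge0.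
  by rewrite lt_min ltr01 invr_gt0.
move=> K' X'; set D := K' - K; rewrite lt_min => /andP[D1 D2] eqX'.
have eK' : K' = K + D by rewrite /D addrC subrK.
clearbody D; subst K'.
have Db : be * `|D| <= 1 / 2.
  by move: D2; rewrite -[_^-1]mul1r ltr_pdivlMr//; have := normr_ge0 D; lra.
have Zb : `|sf_state K *m (X' - X) + (X' - X) *m (sf_state K)^T| <=
    k3 * `|D| + k4 * `|D| * `|D| + k1 * `|D| * `|X'| + k2 * `|X'| * `|D|.
  have := k2P X' D; have := k1P D X'; have := k4P D D; have := k3P D.
  rewrite /= => b3 b4 b1 b2.
  have -> : sf_state K *m (X' - X) + (X' - X) *m (sf_state K)^T =
     - (J1 *m D *m V0 *m (K^T *m J1^T) + J1 *m K *m V0 *m (D^T *m J1^T)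
     + J1 *m D *m V0 *m (D^T *m J1^T) + B0 *m D *m C0 *m X'
     + X' *m (B0 *m D *m C0)^T).
    have -> : sf_state K *m (X' - X) + (X' - X) *m (sf_state K)^T =
        sf_state K *m X' + X' *m (sf_state K)^T + sf_noise K.
      rewrite mulmxBr mulmxBl addrACA -opprD -[LHS]addr0 -eqX addrA.
      by rewrite subrK.
    apply/eqP; rewrite -addr_eq0 -[X in _ == X]eqX'; apply/eqP.
    have -> : sf_state (K + D) = sf_state K + B0 *m D *m C0.
      by rewrite /sf_state mulmxDr mulmxDl addrA.
    have -> : sf_noise (K + D) = sf_noise K + (J1 *m D *m V0 *m (K^T *m J1^T)
        + J1 *m K *m V0 *m (D^T *m J1^T) + J1 *m D *m V0 *m (D^T *m J1^T)).
      rewrite /sf_noise [(K + D)^T]linearD /= !(mulmxDl, mulmxDr) !mulmxA.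
      by rewrite -!addrA; congr (_ + (_ + _)); rewrite addrCA.
    move: (sf_state K) (sf_noise K) (B0 *m D *m C0) => u w T.
    rewrite [(u + T)^T]linearD /= mulmxDl mulmxDr.
    move: (u *m X') (T *m X') (X' *m u^T) (X' *m T^T) => e1 e2 e3 e4.
    move: (J1 *m D *m V0 *m (K^T *m J1^T)) (J1 *m K *m V0 *m (D^T *m J1^T))
      (J1 *m D *m V0 *m (D^T *m J1^T)) => e5 e6 e7.
    by rewrite (AC (3*5) ((1*7)*(2*8)*(3*(4*5*6)))).
  rewrite normrN.
  do 3![rewrite (le_trans (ler_normD _ _))// lerD//].
have X'b : `|X'| <= `|X| + `|X' - X|.
  by rewrite (le_trans _ (ler_normD _ _))// addrC subrK.
have := le_trans (sP _) (ler_wpM2l s0 Zb).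
move: X'b Db D1; rewrite /al beE.
have := normr_ge0 D; have := normr_ge0 X; have := normr_ge0 X'.
have := normr_ge0 (X' - X).
move: `|D| `|X| `|X'| `|X' - X| => a x x' h h0 x'0 x0 a0 X'b Db D1 H.
set y := _ + _ in H.
(* These products feed the linear arithmetic: [h1] lowers the quadratic term in [a] to a linear one
   using [a < 1], and [h2] replaces [x'] by [x + h]. *)
have h1 : 0 <= k4 * a * (1 - a).
  by apply: mulr_ge0; [exact: mulr_ge0 | rewrite subr_ge0 ltW].
have h2 : 0 <= (k1 + k2) * a * (x + h - x').
  by apply: mulr_ge0; rewrite ?subr_ge0// mulr_ge0// addr_ge0.
have yb : y <= (k3 + k4 + (k1 + k2) * x) * a + (k1 + k2) * a * h.
  by rewrite /y; lra.
have := ler_wpM2l s0 yb; move: (ler_wpM2r h0 Db); lra.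
Qed.

Lemma sf_cost_expansion K X Y :
  is_stable (sf_state K) ->
  sf_state K *m X + X *m (sf_state K)^T + sf_noise K = 0 ->
  (sf_state K)^T *m Y + Y *m sf_state K + sf_weight K = 0 ->
  exists k d : R, [/\ 0 <= k, 0 < d & forall K' X', `|K' - K| < d ->
    sf_state K' *m X' + X' *m (sf_state K')^T + sf_noise K' = 0 ->
    `|\tr (sf_weight K' *m X') - \tr (sf_weight K *m X)
       - sf_dcost K X Y (K' - K)| <= k * `|K' - K| ^+ 2].
Proof.
move=> stK eqX eqY; have [g [d [g0 d0 gP]]] := sf_gramian_lipschitz stK eqX.
have [k1 k10 k1P] := mxtrace_bilinear_bound
  (mulmxr J2^T \o mulmx J2 \o
    ((mulmxr K \o mulmxr R0 \o trmx) \+ mulmx (K^T *m R0)))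
  (@idfun 'M[R]_N).
have [k2 k20 k2P] := mxtrace_bilinear_bound
  (mulmxr R0 \o mulmx J2 \o trmx) (mulmxr X \o mulmxr J2^T).
have [k3 k30 k3P] := mxtrace_bilinear_bound
  (mulmxr J2^T \o mulmx J2) (@idfun 'M[R]_N).
have [l l0 lP] := bilinear_bound
  (mulmxr R0 \o @trmx R r c) (@idfun 'M[R]_(r, c)).
have [k4 k40 k4P] := mxtrace_bilinear_bound
  (mulmxr V0 \o mulmx (Y *m J1)) (mulmxr J1^T \o trmx).
have [k5 k50 k5P] := mxtrace_bilinear_bound
  (mulmx Y \o (mulmxr C0 \o mulmx B0)) (@idfun 'M[R]_N).
have [k6 k60 k6P] := mxtrace_bilinear_bound
  (mulmx Y) (trmx \o (mulmxr C0 \o mulmx B0)).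
(* One summand per remainder term: [g] replaces [X' - X] by [D], [l] bounds the quadratic factor of
   the third term, and [|D| < 1] lowers that term from cubic to quadratic. *)
exists (k1 * g + k2 + k3 * l * g + k4 + k5 * g + k6 * g), (Num.min 1 d).
split; first by do ![apply: addr_ge0 | apply: mulr_ge0].
  by rewrite lt_min ltr01.
move=> K' X'; rewrite lt_min => /andP[D1 Dd] eqX'.
have h_le := gP _ _ Dd eqX'.
rewrite (sf_cost_remainder eqX eqY eqX').
move: D1 h_le; set D := K' - K; set H := X' - X => D1 h_le.
have := k1P D H; have := k2P D D; have := k3P (D^T *m R0 *m D) H.
have := lP D D; have := k4P D D; have := k5P D H; have := k6P H D.
rewrite /= => b6 b5 b4 bl b3 b2 b1.
have D0 := normr_ge0 D; have H0 := normr_ge0 H.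
set S := D^T *m R0 *m D in b3 bl *.
apply: (@le_trans _ _ (k1 * `|D| * `|H| + k2 * `|D| * `|D| + k3 * `|S| * `|H|
  + k4 * `|D| * `|D| + k5 * `|D| * `|H| + k6 * `|H| * `|D|)).
  by do 5![apply: (le_trans (ler_normD _ _)); apply: lerD => //].
have S0 := normr_ge0 S; clear b1 b2 b3 b4 b5 b6.
move: (`|D| : R) (`|H| : R) (`|S| : R) D0 H0 S0 D1 bl h_le.
move=> a h t a0 h0 t0 a1 t_le h_le.
have ah : a * h <= g * (a * a) by rewrite mulrCA ler_wpM2l.
have th : t * h <= l * g * (a * a).
  have a3 : a * (a * a) <= a * a by rewrite ler_piMl ?mulr_ge0// ltW.
  have := ler_wpM2l l0 (ler_wpM2l a0 ah); have := ler_wpM2r h0 t_le.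
  by have := ler_wpM2l (mulr_ge0 l0 g0) a3; lra.
have := ler_wpM2l k10 ah; have := ler_wpM2l k50 ah; have := ler_wpM2l k60 ah.
have := ler_wpM2l k30 th; rewrite expr2; lra.
Qed.

End StaticFeedback.

(** * Calculus of intertwined, dilated and compressed matrices *)

Section Dilation.
Variable R : comNzRingType.

(* Meant for coisometries [E] and [F], that is [E *m E^T = 1%:M]. *)
Definition intertwines (a b a' b' : nat) (E : 'M[R]_(a, a')) (F : 'M[R]_(b, b'))
    (M' : 'M[R]_(a', b')) (M : 'M[R]_(a, b)) : Prop :=
  E *m M' = M *m F /\ M' *m F^T = E^T *m M.

(** For coordinate projections [E] and [F], intertwining means that [M'] is block diagonal with
    corner [M] and a free second block. Dilating makes the second block zero; compressing prescribes
    the corner only. *)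
Definition dilates (a b a' b' : nat) (E : 'M[R]_(a, a')) (F : 'M[R]_(b, b'))
    (M' : 'M[R]_(a', b')) (M : 'M[R]_(a, b)) : Prop :=
  M' = E^T *m M *m F.

Definition compresses (a b a' b' : nat) (E : 'M[R]_(a, a')) (F : 'M[R]_(b, b'))
    (M' : 'M[R]_(a', b')) (M : 'M[R]_(a, b)) : Prop :=
  E *m M' *m F^T = M.

Variables (a b c a' b' c' : nat).
Variables (E : 'M[R]_(a, a')) (F : 'M[R]_(b, b')) (G : 'M[R]_(c, c')).

Lemma intertwinesM (M' : 'M[R]_(a', b')) (M : 'M[R]_(a, b))
    (N' : 'M[R]_(b', c')) (N : 'M[R]_(b, c)) :
  intertwines E F M' M -> intertwines F G N' N ->
  intertwines E G (M' *m N') (M *m N).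
Proof.
move=> [EM MF] [FN NG]; split; first by rewrite mulmxA EM -!mulmxA FN.
by rewrite -mulmxA NG !mulmxA MF.
Qed.

Lemma intertwinesD (M' : 'M[R]_(a', b')) (M : 'M[R]_(a, b))
    (N' : 'M[R]_(a', b')) (N : 'M[R]_(a, b)) :
  intertwines E F M' M -> intertwines E F N' N ->
  intertwines E F (M' + N') (M + N).
Proof.
move=> [EM MF] [EN NF].
by split; rewrite mulmxDr mulmxDl ?EM ?EN ?MF ?NF// ?mulmxDr ?mulmxDl.
Qed.

Lemma intertwines_tr (M' : 'M[R]_(a', b')) (M : 'M[R]_(a, b)) :
  intertwines E F M' M -> intertwines F E M'^T M^T.
Proof.
by move=> [EM MF]; split; apply: trmx_inj; rewrite !trmx_mul !trmxK.
Qed.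

Lemma dilates_intertwines (M' : 'M[R]_(a', b')) (M : 'M[R]_(a, b)) :
  E *m E^T = 1%:M -> F *m F^T = 1%:M -> dilates E F M' M ->
  intertwines E F M' M.
Proof.
move=> EE FF ->; split; first by rewrite !mulmxA EE mul1mx.
by rewrite -!mulmxA FF mulmx1.
Qed.

Lemma dilatesD (M' : 'M[R]_(a', b')) (M : 'M[R]_(a, b))
    (N' : 'M[R]_(a', b')) (N : 'M[R]_(a, b)) :
  dilates E F M' M -> dilates E F N' N -> dilates E F (M' + N') (M + N).
Proof. by move=> -> ->; rewrite /dilates mulmxDr mulmxDl. Qed.

Lemma dilatesMl (M' : 'M[R]_(a', b')) (M : 'M[R]_(a, b))
    (N' : 'M[R]_(b', c')) (N : 'M[R]_(b, c)) :
  intertwines E F M' M -> dilates F G N' N -> dilates E G (M' *m N') (M *m N).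
Proof. by move=> [_ MF] ->; rewrite /dilates !mulmxA MF. Qed.

Lemma dilatesMr (M' : 'M[R]_(a', b')) (M : 'M[R]_(a, b))
    (N' : 'M[R]_(b', c')) (N : 'M[R]_(b, c)) :
  dilates E F M' M -> intertwines F G N' N -> dilates E G (M' *m N') (M *m N).
Proof. by move=> -> [FN _]; rewrite /dilates -!mulmxA FN. Qed.

Lemma compressesD (M' : 'M[R]_(a', b')) (M : 'M[R]_(a, b))
    (N' : 'M[R]_(a', b')) (N : 'M[R]_(a, b)) :
  compresses E F M' M -> compresses E F N' N ->
  compresses E F (M' + N') (M + N).
Proof. by move=> <- <-; rewrite /compresses mulmxDr mulmxDl. Qed.

Lemma compressesMl (M' : 'M[R]_(a', b')) (M : 'M[R]_(a, b))
    (N' : 'M[R]_(b', c')) (N : 'M[R]_(b, c)) :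
  intertwines E F M' M -> compresses F G N' N ->
  compresses E G (M' *m N') (M *m N).
Proof. by move=> [EM _] <-; rewrite /compresses !mulmxA EM. Qed.

Lemma compressesMr (M' : 'M[R]_(a', b')) (M : 'M[R]_(a, b))
    (N' : 'M[R]_(b', c')) (N : 'M[R]_(b, c)) :
  compresses E F M' M -> intertwines F G N' N ->
  compresses E G (M' *m N') (M *m N).
Proof. by move=> <- [_ NG]; rewrite /compresses -!mulmxA NG !mulmxA. Qed.

Lemma compresses_tr (M' : 'M[R]_(a', b')) (M : 'M[R]_(a, b)) :
  compresses E F M' M -> compresses F E M'^T M^T.
Proof. by move=> <-; rewrite /compresses !trmx_mul !trmxK mulmxA. Qed.

Lemma dilates_compresses (M' : 'M[R]_(a', b')) (M : 'M[R]_(a, b)) :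
  E *m E^T = 1%:M -> F *m F^T = 1%:M -> dilates E F M' M ->
  compresses E F M' M.
Proof.
by move=> EE FF ->; rewrite /compresses !mulmxA EE mul1mx -mulmxA FF mulmx1.
Qed.

(** The dilated factor is [F^T N E]; by cyclicity its outer factors compress [M'], so the trace sees
    nothing else of [M']. *)
Lemma mxtrace_compresses_dilates (M' : 'M[R]_(a', b')) (M : 'M[R]_(a, b))
    (N' : 'M[R]_(b', a')) (N : 'M[R]_(b, a)) :
  compresses E F M' M -> dilates F E N' N -> \tr (M' *m N') = \tr (M *m N).
Proof.
by move=> <- ->; rewrite -!mulmxA [RHS]mxtrace_mulC !mulmxA.
Qed.

End Dilation.

(** * Gramian, adjoint solution, cost and derivative under dilation *)

Section FeedbackDilation.
Variables (R : realType) (N r c N' r' c' : nat).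
Variables (A0 : 'M[R]_N) (B0 : 'M[R]_(N, r)) (C0 : 'M[R]_(c, N)).
Variables (W0 : 'M[R]_N) (J1 : 'M[R]_(N, r)) (V0 : 'M[R]_c).
Variables (Q0 : 'M[R]_N) (J2 : 'M[R]_(N, c)) (R0 : 'M[R]_r).
Variables (A0' : 'M[R]_N') (B0' : 'M[R]_(N', r')) (C0' : 'M[R]_(c', N')).
Variables (W0' : 'M[R]_N') (J1' : 'M[R]_(N', r')) (V0' : 'M[R]_c').
Variables (Q0' : 'M[R]_N') (J2' : 'M[R]_(N', c')) (R0' : 'M[R]_r').
Variables (E : 'M[R]_(N, N')) (F : 'M[R]_(r, r')) (G : 'M[R]_(c, c')).
Variables (K : 'M[R]_(r, c)) (K' : 'M[R]_(r', c')) (X Y : 'M[R]_N).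
Hypotheses (EE : E *m E^T = 1%:M) (FF : F *m F^T = 1%:M) (GG : G *m G^T = 1%:M).
Hypotheses (dA : dilates E E A0' A0) (dW : dilates E E W0' W0).
Hypotheses (dV : dilates G G V0' V0) (dQ : dilates E E Q0' Q0).
Hypotheses (dR : dilates F F R0' R0).
Hypotheses (iB : intertwines E F B0' B0) (iC : intertwines G E C0' C0).
Hypotheses (iJ1 : intertwines E F J1' J1) (iJ2 : intertwines E G J2' J2).
Hypothesis iK : intertwines F G K' K.

Let X' := E^T *m X *m E.
Let Y' := E^T *m Y *m E.

Lemma sf_state_intertwines :
  intertwines E E (sf_state A0' B0' C0' K') (sf_state A0 B0 C0 K).
Proof.
apply: intertwinesD; first exact: dilates_intertwines.
exact: intertwinesM (intertwinesM iB iK) iC.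
Qed.

Lemma sf_noise_dilates :
  dilates E E (sf_noise W0' J1' V0' K') (sf_noise W0 J1 V0 K).
Proof.
apply: dilatesD => //; apply: (dilatesMr _ (intertwines_tr iJ1)).
apply: (dilatesMl iJ1); apply: (dilatesMr _ (intertwines_tr iK)).
exact: dilatesMl iK dV.
Qed.

Lemma sf_weight_dilates :
  dilates E E (sf_weight Q0' J2' R0' K') (sf_weight Q0 J2 R0 K).
Proof.
apply: dilatesD => //; apply: (dilatesMr _ (intertwines_tr iJ2)).
apply: (dilatesMl iJ2); apply: (dilatesMr _ iK).
exact: dilatesMl (intertwines_tr iK) dR.
Qed.

Lemma sf_gramian_dilates :
  sf_state A0 B0 C0 K *m X + X *m (sf_state A0 B0 C0 K)^T
    + sf_noise W0 J1 V0 K = 0 ->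
  sf_state A0' B0' C0' K' *m X' + X' *m (sf_state A0' B0' C0' K')^T
    + sf_noise W0' J1' V0' K' = 0.
Proof.
have is_ := sf_state_intertwines; move=> eqX.
(* The left-hand side at [K'] dilates the one at [K], which is zero, and only zero dilates zero. *)
suff : forall M : 'M[R]_N', dilates E E M 0 -> M = 0.
  apply; rewrite -eqX; apply: dilatesD sf_noise_dilates; apply: dilatesD.
    exact: dilatesMl is_ (erefl X').
  exact: dilatesMr (erefl X') (intertwines_tr is_).
by move=> M ->; rewrite mulmx0 mul0mx.
Qed.

Lemma sf_adjoint_dilates :
  (sf_state A0 B0 C0 K)^T *m Y + Y *m sf_state A0 B0 C0 K
    + sf_weight Q0 J2 R0 K = 0 ->
  (sf_state A0' B0' C0' K')^T *m Y' + Y' *m sf_state A0' B0' C0' K'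
    + sf_weight Q0' J2' R0' K' = 0.
Proof.
have is_ := sf_state_intertwines; move=> eqY.
suff : forall M : 'M[R]_N', dilates E E M 0 -> M = 0.
  apply; rewrite -eqY; apply: dilatesD sf_weight_dilates; apply: dilatesD.
    exact: dilatesMl (intertwines_tr is_) (erefl Y').
  exact: dilatesMr (erefl Y') is_.
by move=> M ->; rewrite mulmx0 mul0mx.
Qed.

Lemma sf_cost_dilates :
  \tr (sf_weight Q0' J2' R0' K' *m X') = \tr (sf_weight Q0 J2 R0 K *m X).
Proof.
apply: mxtrace_compresses_dilates (erefl X').
exact: dilates_compresses sf_weight_dilates.
Qed.

(** In each term [D'] is compressed and [X'] or [Y'] can be placed last as a dilated factor, while
    everything between them intertwines. *)
Lemma sf_dcost_compresses (D' : 'M[R]_(r', c')) :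
  sf_dcost B0' C0' J1' V0' J2' R0' K' X' Y' D' =
  sf_dcost B0 C0 J1 V0 J2 R0 K X Y (F *m D' *m G^T).
Proof.
set D := F *m D' *m G^T.
have cD : compresses F G D' D by [].
have iR := dilates_intertwines FF FF dR.
have iV := dilates_intertwines GG GG dV.
have iX : intertwines E E X' X by apply: dilates_intertwines.
have iKt := intertwines_tr iK; have cDt := compresses_tr cD.
congr (_ + _ + _).
- apply: mxtrace_compresses_dilates (erefl X').
  apply: (compressesMr _ (intertwines_tr iJ2)); apply: (compressesMl iJ2).
  apply: compressesD; first exact: compressesMr (compressesMr cDt iR) iK.
  exact: compressesMl (intertwinesM iKt iR) cD.
- rewrite mxtrace_mulC [RHS]mxtrace_mulC.
  apply: mxtrace_compresses_dilates (erefl Y').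
  apply: (compressesMr _ (intertwines_tr iJ1)); apply: (compressesMl iJ1).
  apply: compressesD; first exact: compressesMr (compressesMr cD iV) iKt.
  exact: compressesMl (intertwinesM iK iV) cDt.
- rewrite mxtrace_mulC [RHS]mxtrace_mulC.
  apply: mxtrace_compresses_dilates (erefl Y').
  have cT : compresses E E (B0' *m D' *m C0') (B0 *m D *m C0).
    exact: compressesMr (compressesMl iB cD) iC.
  apply: compressesD; first exact: compressesMr cT iX.
  exact: compressesMl iX (compresses_tr cT).
Qed.

End FeedbackDilation.

(** * Padded plant data and coordinate projections *)

Section Padding.
Variable R : realType.

(** The controller state is appended to the plant: [pad1] passes it through unchanged, [pad0] gives
    it no contribution. This makes a dynamical controller a static gain. *)
Definition pad0 (a b q : nat) (M : 'M[R]_(a, b)) : 'M[R]_(a + q, b + q) :=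
  block_mx M 0 0 0.

Definition pad1 (a b q : nat) (M : 'M[R]_(a, b)) : 'M[R]_(a + q, b + q) :=
  block_mx M 0 0 1%:M.

(** The projection forgetting the last [q'] coordinates; the nested blocks follow the bracketing
    [a + (q + q')] and avoid casts. *)
Definition embed (a q q' : nat) : 'M[R]_(a + q, a + (q + q')) :=
  block_mx 1%:M 0 0 (row_mx 1%:M 0).

Lemma tr_embed (a q q' : nat) :
  (embed a q q')^T = block_mx 1%:M 0 0 (col_mx 1%:M 0).
Proof. by rewrite tr_block_mx tr_row_mx !trmx1 !trmx0. Qed.

Variables (a b q q' : nat).

Lemma embed_isometry : embed a q q' *m (embed a q q')^T = 1%:M.
Proof.
rewrite tr_embed mulmx_block mul_row_col.
rewrite !(mulmx0, mul0mx, mulmx1, addr0, add0r).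
by rewrite -scalar_mx_block.
Qed.

Lemma pad0_dilates (M : 'M[R]_(a, b)) :
  dilates (embed a q q') (embed b q q') (pad0 (q + q') M) (pad0 q M).
Proof.
rewrite /dilates /pad0 tr_embed !mulmx_block.
rewrite !(mulmx0, mul0mx, mulmx1, mul1mx, addr0, add0r).
by f_equal.
Qed.

Lemma pad1_intertwines (M : 'M[R]_(a, b)) :
  intertwines (embed a q q') (embed b q q') (pad1 (q + q') M) (pad1 q M).
Proof.
rewrite /intertwines !tr_embed /pad1 /embed.
by split; rewrite !mulmx_block !(mulmx0, mul0mx, mulmx1, mul1mx, addr0, add0r);
  f_equal.
Qed.

End Padding.

(** * The LQG problem as static output feedback *)

Section Controllers.
Variables (R : realType) (n m p : nat).
Variables (A : 'M[R]_n) (B : 'M[R]_(n, m)) (C : 'M[R]_(p, n)).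
Variables (W : 'M[R]_n) (V : 'M[R]_p) (Q : 'M[R]_n) (Rw : 'M[R]_m).

Section Order.
Variable q : nat.
Implicit Types (K D : 'M[R]_(m + q, p + q)) (X Y : 'M[R]_(n + q)).

Lemma ctrl_spaceP K : ctrl_space K <-> ulsubmx K = 0.
Proof.
split=> [[AK [BK [CK ->]]]|K0]; first by rewrite block_mxKul.
exists (drsubmx K), (dlsubmx K), (ursubmx K).
by rewrite -[LHS]submxK K0.
Qed.

(* Padding by a zero block kills the entries of [K] that do not occur in the
   noise and weight matrices. *)
Definition lqg_state := sf_state (pad0 q A) (pad1 q B) (pad1 q C).
Definition lqg_noise :=
  sf_noise (pad0 q W) (pad1 q (0 : 'M[R]_(n, m))) (pad0 q V).
Definition lqg_weight :=
  sf_weight (pad0 q Q) (pad1 q (0 : 'M[R]_(n, p))) (pad0 q Rw).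
Definition lqg_dcost := sf_dcost (pad1 q B) (pad1 q C)
  (pad1 q (0 : 'M[R]_(n, m))) (pad0 q V)
  (pad1 q (0 : 'M[R]_(n, p))) (pad0 q Rw).

(** The zero feedthrough block matters: otherwise [sf_state] would add its product with [B] and [C]
    to [A]. *)
Lemma closed_loopE K : ctrl_space K -> closed_loop A B C K = lqg_state K.
Proof.
move=> /ctrl_spaceP K0; rewrite /lqg_state /sf_state -[K in RHS]submxK K0.
rewrite !mulmx_block !(mulmx0, mul0mx, mulmx1, mul1mx, addr0, add0r).
by rewrite add_block_mx !(addr0, add0r).
Qed.

Lemma lqg_noiseE K : ctrl_space K ->
  block_mx W 0 0 (ctrlB K *m V *m (ctrlB K)^T) = lqg_noise K.
Proof.
move=> /ctrl_spaceP K0; rewrite /lqg_noise /sf_noise -[K in RHS]submxK K0.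
rewrite !tr_block_mx !trmx0 trmx1.
rewrite !mulmx_block !(mulmx0, mul0mx, mulmx1, mul1mx, addr0, add0r).
by rewrite add_block_mx !(addr0, add0r).
Qed.

Lemma lqg_weightE K : ctrl_space K ->
  block_mx Q 0 0 ((ctrlC K)^T *m Rw *m ctrlC K) = lqg_weight K.
Proof.
move=> /ctrl_spaceP K0; rewrite /lqg_weight /sf_weight -[K in RHS]submxK K0.
rewrite !tr_block_mx !trmx0 trmx1.
rewrite !mulmx_block !(mulmx0, mul0mx, mulmx1, mul1mx, addr0, add0r).
by rewrite add_block_mx !(addr0, add0r).
Qed.

Lemma stabilizing_state K : stabilizing A B C K -> is_stable (lqg_state K).
Proof. by case=> KC stK; rewrite -closed_loopE. Qed.

Lemma lqg_gramian_exists K : stabilizing A B C K ->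
  exists X, lqg_state K *m X + X *m (lqg_state K)^T + lqg_noise K = 0.
Proof.
move=> /stabilizing_state stK.
have [s _ sP] := sylvester_solve stK (stable_trmx stK).
by have [X eqX _] := sP (- lqg_noise K); exists X; rewrite eqX addNr.
Qed.

Lemma lqg_adjoint_exists K : stabilizing A B C K ->
  exists Y, (lqg_state K)^T *m Y + Y *m lqg_state K + lqg_weight K = 0.
Proof.
move=> /stabilizing_state stK.
have [s _ sP] := sylvester_solve (stable_trmx stK) stK.
by have [Y eqY _] := sP (- lqg_weight K); exists Y; rewrite eqY addNr.
Qed.

(** Since [X] is a solution, [xget] returns a solution too, and injectivity of the Sylvester
    operator identifies it with [X]. *)
Lemma lqg_costE K X : stabilizing A B C K ->
  lqg_state K *m X + X *m (lqg_state K)^T + lqg_noise K = 0 ->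
  lqg_cost A B C W V Q Rw K = \tr (lqg_weight K *m X).
Proof.
move=> K_stab eqX; have [KC _] := K_stab; have stK := stabilizing_state K_stab.
rewrite /lqg_cost lqg_weightE//; congr (\tr (_ *m _)).
have eqS : lyapunov_eq A B C W V K X.
  by rewrite /lyapunov_eq closed_loopE// lqg_noiseE.
have := xgetI 0 eqS; rewrite -/(lyapunov_sol A B C W V K).
move: (lyapunov_sol _ _ _ _ _ _) => S.
rewrite /lyapunov_eq /= closed_loopE// lqg_noiseE// => eqS'.
apply/eqP; rewrite -subr_eq0; apply/eqP.
apply: (sylvester_inj stK (stable_trmx stK)).
rewrite mulmxBr mulmxBl addrACA -opprD.
by apply/eqP; rewrite subr_eq0 -(inj_eq (addIr (lqg_noise K))) eqS' eqX.
Qed.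

(** Clearing the denominator turns the limit into an estimate that holds trivially at [K' = K]. *)
Lemma is_gradient0P (S : set 'M[R]_(m + q, p + q)) J K :
  is_gradient S J K 0 <->
  forall e, 0 < e -> exists2 d, 0 < d &
    forall K', `|K' - K| < d -> S K' -> `|J K' - J K| <= e * `|K' - K|.
Proof.
have C0 : ctrl_space (0 : 'M[R]_(m + q, p + q)).
  by apply/ctrl_spaceP; apply/matrixP => i j; rewrite !mxE.
split=> [[_ /cvgr0Pnorm_le H] e e0|H].
  have := H e e0; rewrite near_withinE nearE => /nbhs_normP[d /= d0 dP].
  exists d => // K' K'd SK'.
  have [->|K'K] := eqVneq K' K; first by rewrite !subrr !normr0 mulr0.
  have /(_ _ K'K SK') := dP K' _; rewrite /= distrC => /(_ K'd).
  rewrite trmx0 mul0mx mxtrace0 subr0 normrM normfV normr_id.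
  by rewrite ler_pdivrMr// normr_gt0 subr_eq0.
split=> //; apply/cvgr0Pnorm_le => e e0.
have [d d0 dP] := H e e0.
have near_d : \forall K' \near K, `|K - K'| < d by apply/nbhs_normP; exists d.
rewrite 2!near_withinE; apply: filterS near_d => K' /= K'd K'K SK'.
rewrite trmx0 mul0mx mxtrace0 subr0 normrM normfV normr_id.
rewrite ler_pdivrMr ?normr_gt0 ?subr_eq0//; apply: dP => //.
by rewrite distrC.
Qed.

End Order.
End Controllers.

(** * Stationarity as vanishing of the explicit derivative *)

Section Stationarity.
Variables (R : realType) (n m p q : nat).
Variables (A : 'M[R]_n) (B : 'M[R]_(n, m)) (C : 'M[R]_(p, n)).
Variables (W : 'M[R]_n) (V : 'M[R]_p) (Q : 'M[R]_n) (Rw : 'M[R]_m).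
Implicit Types (K D : 'M[R]_(m + q, p + q)) (X Y : 'M[R]_(n + q)).

Local Notation J := (lqg_cost A B C W V Q Rw).

Lemma ctrl_space_linear t D K :
  ctrl_space D -> ctrl_space K -> ctrl_space (t *: D + K).
Proof.
move=> /ctrl_spaceP D0 /ctrl_spaceP K0; apply/ctrl_spaceP/matrixP => i j.
move/matrixP/(_ i j): D0; move/matrixP/(_ i j): K0; rewrite !mxE => -> ->.
by rewrite mulr0 addr0.
Qed.

Lemma stabilizing_open K : stabilizing A B C K ->
  exists2 d : R, 0 < d &
    forall K', `|K' - K| < d -> ctrl_space K' -> stabilizing A B C K'.
Proof.
move=> K_stab; have [d d0 dP] := stable_open (stabilizing_state K_stab).
have [k k0 kP] := linear_bound (mulmxr (pad1 q C) \o mulmx (pad1 q B)).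
have k1 : 0 < k + 1 by rewrite ltr_wpDl.
exists (d / (k + 1)); first by rewrite divr_gt0.
move=> K' K'd K'C; split=> //; rewrite closed_loopE//; apply: dP.
have -> : lqg_state A B C K' - lqg_state A B C K =
    pad1 q B *m (K' - K) *m pad1 q C.
  by rewrite /lqg_state /sf_state opprD addrACA subrr add0r mulmxBr mulmxBl.
apply: (le_lt_trans (kP (K' - K))); move: K'd; rewrite ltr_pdivlMr//.
by apply: le_lt_trans; rewrite mulrC ler_wpM2l// lerDl.
Qed.

Lemma lqg_cost_expansion K X Y : stabilizing A B C K ->
  lqg_state A B C K *m X + X *m (lqg_state A B C K)^T + lqg_noise W V K = 0 ->
  (lqg_state A B C K)^T *m Y + Y *m lqg_state A B C K + lqg_weight Q Rw K = 0 ->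
  exists k d : R, [/\ 0 <= k, 0 < d & forall K', `|K' - K| < d ->
    stabilizing A B C K' ->
    `|J K' - J K - lqg_dcost B C V Rw K X Y (K' - K)| <= k * `|K' - K| ^+ 2].
Proof.
move=> K_stab eqX eqY.
have [k [d [k0 d0 kP]]] := sf_cost_expansion (stabilizing_state K_stab) eqX eqY.
exists k, d; split=> // K' K'd K'_stab.
have [X' eqX'] := lqg_gramian_exists W V K'_stab.
rewrite (lqg_costE Q Rw K_stab eqX) (lqg_costE Q Rw K'_stab eqX').
exact: kP.
Qed.

(** If the derivative vanishes, only the quadratic remainder is left. Conversely, along [K + t D] a
    nonzero derivative [phi] would give [t |phi| <= t |phi| / 4 + t |phi| / 8] for a small
    [t > 0]. *)
Lemma stationaryP K X Y : stabilizing A B C K ->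
  lqg_state A B C K *m X + X *m (lqg_state A B C K)^T + lqg_noise W V K = 0 ->
  (lqg_state A B C K)^T *m Y + Y *m lqg_state A B C K + lqg_weight Q Rw K = 0 ->
  is_gradient (@stabilizing R n m p q A B C) J K 0 <->
  forall D, ctrl_space D -> lqg_dcost B C V Rw K X Y D = 0.
Proof.
move=> K_stab eqX eqY.
have [k [d1 [k0 d1_gt0 kP]]] := lqg_cost_expansion K_stab eqX eqY.
split=> [/is_gradient0P gradK D DC|dcost0]; last first.
  apply/is_gradient0P => e e0; exists (Num.min d1 (e / (k + 1))).
    by rewrite lt_min d1_gt0 divr_gt0// ltr_wpDl.
  move=> K'; rewrite lt_min ltr_pdivlMr ?ltr_wpDl// => /andP[K'd K'e] K'_stab.
  have := kP K' K'd K'_stab; rewrite dcost0 ?subr0; last first.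
    rewrite addrC -scaleN1r.
    exact: ctrl_space_linear (proj1 K_stab) (proj1 K'_stab).
  move/le_trans; apply; rewrite expr2 mulrA ler_wpM2r//.
  by have := normr_ge0 (K' - K); lra.
have [d2 d2_gt0 K_open] := stabilizing_open K_stab.
apply/eqP/negPn/negP => phi0; set phi := lqg_dcost _ _ _ _ _ _ _ _ in phi0.
(* The added 1 keeps the divisor positive when [D = 0]. *)
pose M := `|D| + 1; have M0 : 0 < M by rewrite ltr_wpDl.
have phi_gt0 : 0 < `|phi| by rewrite normr_gt0.
have e_gt0 : 0 < `|phi| / (4 * M) by rewrite divr_gt0// mulr_gt0.
have [d3 d3_gt0 gradP] := gradK (`|phi| / (4 * M)) e_gt0.
have dd : 0 < `|phi| / (4 * (k + 1) * M).
  by rewrite divr_gt0// !mulr_gt0// ltr_wpDl.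
(* The first three radii serve the expansion, openness and the gradient estimate; the last makes the
   quadratic remainder at most [t |phi| / 8]. *)
pose d := Num.min (Num.min d1 d2) (Num.min d3 (`|phi| / (4 * (k + 1) * M))).
have d_gt0 : 0 < d by rewrite !lt_min d1_gt0 d2_gt0 d3_gt0.
pose t := d / M / 2; have t0 : 0 < t by rewrite !divr_gt0.
have tD : `|K + t *: D - K| = t * `|D|.
  by rewrite addrC addKr mx_normZ gtr0_norm.
have tM : t * M = d / 2 by rewrite /t mulrAC divfK ?gt_eqF.
have tDM : t * `|D| <= t * M by rewrite ler_pM2l// lerDl.
have d_le : d * (4 * (k + 1) * M) <= `|phi|.
  by rewrite -ler_pdivlMr ?mulr_gt0 ?ltr_wpDl// !ge_min lexx !orbT.
have : t * `|D| < d by lra.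
rewrite !lt_min => /andP[/andP[b1 b2] /andP[b3 _]].
have KtC : ctrl_space (K + t *: D).
  by rewrite addrC; apply: ctrl_space_linear (proj1 K_stab).
have Kt_stab : stabilizing A B C (K + t *: D) by apply: K_open; rewrite ?tD.
have := kP (K + t *: D); rewrite tD => /(_ b1 Kt_stab).
have := gradP (K + t *: D); rewrite tD => /(_ b3 Kt_stab).
rewrite [K + _]addrC addrK /lqg_dcost sf_dcostZ.
rewrite -/(lqg_dcost _ _ _ _ _ _ _ _) -/phi.
set dJ := _ - J K => grad_le exp_le.
have : t * `|phi| <= `|phi| / (4 * M) * (t * `|D|) + k * (t * `|D|) ^+ 2.
  rewrite -[X in X * `|phi|](gtr0_norm t0) -normrM.
  rewrite (le_trans _ (lerD grad_le exp_le))//.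
  by rewrite -[X in `|X|](subKr dJ) ler_normB.
have : `|phi| / (4 * M) * (t * `|D|) <= t * `|phi| / 4.
  have -> : t * `|phi| / 4 = `|phi| / (4 * M) * (t * M).
    by field; rewrite gt_eqF.
  by rewrite ler_wpM2l// ltW.
have : k * (t * `|D|) ^+ 2 <= t * `|phi| / 8.
  have tD0 : 0 <= t * `|D| by rewrite mulr_ge0// ltW.
  have : k * (t * `|D|) ^+ 2 <= k * (t * M) ^+ 2.
    by rewrite ler_wpM2l// !expr2 ler_pM.
  have := ler_wpM2l (ltW t0) d_le.
  have : 0 < t * d * M by do 2!apply: mulr_gt0 => //.
  have -> : k * (t * M) ^+ 2 = k * (t * M) * M * t by ring.
  by rewrite tM; lra.
have : 0 < t * `|phi| by rewrite mulr_gt0.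
move: (t * `|phi|) (`|phi| / _ * _) (k * _) => x y z; lra.
Qed.

End Stationarity.

(** * Stability of the augmented closed loop *)

(* [P] and [S] span complementary invariant subspaces. *)
Lemma stable_of_invariant_split (R : realType) (N r s : nat) (M : 'M[R]_N)
    (P : 'M[R]_(N, r)) (S : 'M[R]_(N, s)) (M1 : 'M[R]_r) (M2 : 'M[R]_s) :
  P *m P^T + S *m S^T = 1%:M -> M *m P = P *m M1 -> M *m S = S *m M2 ->
  is_stable M1 -> is_stable M2 -> is_stable M.
Proof.
move=> PS1 MP MS stM1 stM2 z /eigenvalueP[v eqv v0].
have eigen t (T : 'M[R]_(N, t)) (M3 : 'M[R]_t) :
    M *m T = T *m M3 -> is_stable M3 -> v *m toC T != 0 -> complex.Re z < 0.
  move=> MT stM3 vT0; apply: stM3; apply/eigenvalueP; exists (v *m toC T) => //.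
  by rewrite -mulmxA -map_mxM -MT map_mxM mulmxA eqv scalemxAl.
(* A nonzero [v P] or [v S] is a left eigenvector of [M1] or [M2] for [z]; both vanish only if
   [v = 0]. *)
have [vP|] := eqVneq (v *m toC P) 0; last exact: eigen MP stM1.
have [vS|] := eqVneq (v *m toC S) 0; last exact: eigen MS stM2.
case/eqP: v0; rewrite -[v]mulmx1 -(map_mx1 (real_complex R)) -PS1.
by rewrite map_mxD !map_mxM mulmxDr !mulmxA vP vS !mul0mx addr0.
Qed.

Section Augmentation.
Variables (R : realType) (n m p q q' : nat).
Variables (A : 'M[R]_n) (B : 'M[R]_(n, m)) (C : 'M[R]_(p, n)).
Variables (AK : 'M[R]_q) (BK : 'M[R]_(q, p)) (CK : 'M[R]_(m, q)) (L : 'M[R]_q').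

Local Notation K := (ctrl_mx AK BK CK).
Local Notation Kaug :=
  (ctrl_mx (block_mx AK 0 0 L) (col_mx BK 0) (row_mx CK 0)).

Lemma ctrl_mx_intertwines :
  intertwines (embed R m q q') (embed R p q q') Kaug K.
Proof.
rewrite /intertwines !tr_embed /ctrl_mx /embed.
split; rewrite !mulmx_block !(mulmx0, mul0mx, mulmx1, mul1mx, addr0, add0r).
  rewrite mul_row_col mul_row_block !mul_mx_row.
  by rewrite !(mulmx0, mul0mx, mulmx1, mul1mx, addr0, add0r).
rewrite mul_row_col mul_block_col !mul_col_mx.
by rewrite !(mulmx0, mul0mx, mulmx1, mul1mx, addr0, add0r).
Qed.

Lemma ctrl_space_compress (D : 'M[R]_(m + (q + q'), p + (q + q'))) :
  ctrl_space D -> ctrl_space (embed R m q q' *m D *m (embed R p q q')^T).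
Proof.
move=> [D1 [D2 [D3 ->]]]; apply/ctrl_spaceP.
rewrite tr_embed /embed /ctrl_mx !mulmx_block block_mxKul.
by rewrite !(mulmx0, mul0mx, mulmx1, mul1mx, addr0, add0r).
Qed.

Lemma stabilizing_augment :
  stabilizing A B C K -> is_stable L -> stabilizing A B C Kaug.
Proof.
move=> K_stab stL; split; first by do 3!eexists.
(* [S] includes the coordinates of [L], on which the closed loop acts as [L]; on the complementary
   coordinates it acts as the original closed loop. *)
pose S : 'M[R]_(n + (q + q'), q') := col_mx 0 (col_mx 0 1%:M).
apply: (@stable_of_invariant_split _ _ _ _ _ (embed R n q q')^T S) _ _
  (proj2 K_stab) stL.
- rewrite trmxK tr_embed /embed /S mulmx_block !tr_col_mx !trmx0 trmx1.
  rewrite !mul_col_row.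
  rewrite !(mulmx0, mul0mx, mulmx1, mul1mx, addr0, add0r, add_block_mx).
  by rewrite -!scalar_mx_block.
- rewrite !closed_loopE; try by do 3!eexists.
  exact: (sf_state_intertwines (embed_isometry R n q q') (pad0_dilates q q' A)
    (pad1_intertwines q q' B) (pad1_intertwines q q' C) ctrl_mx_intertwines).2.
rewrite /closed_loop /ctrlA /ctrlB /ctrlC /ctrl_mx.
rewrite block_mxKdr block_mxKdl block_mxKur.
rewrite /S !(mul_block_col, mul_col_mx, mul_mx_row, mul_row_col).
rewrite !(mulmx0, mul0mx, mulmx1, mul1mx, addr0, add0r).
by rewrite add_col_mx !add0r.
Qed.

End Augmentation.

(** * Stationarity and cost of the augmented controller *)

Theorem theorem4p1 (R : realType) (n m p : nat)
    (n_ge1 : (1 <= n)%N) (m_ge1 : (1 <= m)%N) (p_ge1 : (1 <= p)%N)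
    (A : 'M[R]_n) (B : 'M[R]_(n, m)) (C : 'M[R]_(p, n))
    (W : 'M[R]_n) (V : 'M[R]_p) (Q : 'M[R]_n) (Rw : 'M[R]_m)
    (W_psd : psdmx W) (V_pd : pdmx V) (Q_psd : psdmx Q) (Rw_pd : pdmx Rw)
    (AB_ctrb : controllable A B) (AW_ctrb : controllable A (sqrtmx W))
    (CA_obsv : observable C A) (QA_obsv : observable (sqrtmx Q) A)
    (q : nat) (q_ge1 : (1 <= q)%N)
    (AK : 'M[R]_q) (BK : 'M[R]_(q, p)) (CK : 'M[R]_(m, q))
    (K_stab : stabilizing A B C (ctrl_mx AK BK CK))
    (K_stat : is_gradient (@stabilizing R n m p q A B C)
                (lqg_cost A B C W V Q Rw) (ctrl_mx AK BK CK) 0)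
    (q' : nat) (q'_ge1 : (1 <= q')%N)
    (L : 'M[R]_q') (L_stable : is_stable L) :
  let K' : 'M[R]_(m + (q + q'), p + (q + q')) :=
    ctrl_mx (block_mx AK 0 0 L) (col_mx BK 0) (row_mx CK 0) in
  [/\ stabilizing A B C K',
      is_gradient (@stabilizing R n m p (q + q') A B C)
        (lqg_cost A B C W V Q Rw) K' 0
    & lqg_cost A B C W V Q Rw K' =
      lqg_cost A B C W V Q Rw (ctrl_mx AK BK CK)].
Proof.
set K := ctrl_mx AK BK CK => K'.
have K'_stab : stabilizing A B C K' by apply: stabilizing_augment.
have iK : intertwines (embed R m q q') (embed R p q q') K' K.
  exact: ctrl_mx_intertwines.
have [X eqX] := lqg_gramian_exists W V K_stab.
have [Y eqY] := lqg_adjoint_exists Q Rw K_stab.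
have En := embed_isometry R n q q'.
have Em := embed_isometry R m q q'.
have Ep := embed_isometry R p q q'.
have eqX' := sf_gramian_dilates En (pad0_dilates q q' A) (pad0_dilates q q' W)
  (pad0_dilates q q' V) (pad1_intertwines q q' B) (pad1_intertwines q q' C)
  (pad1_intertwines q q' 0) iK eqX.
have eqY' := sf_adjoint_dilates En (pad0_dilates q q' A) (pad0_dilates q q' Q)
  (pad0_dilates q q' Rw) (pad1_intertwines q q' B) (pad1_intertwines q q' C)
  (pad1_intertwines q q' 0) iK eqY.
split=> //.
  apply/(stationaryP K'_stab eqX' eqY') => D DC.
  have /(stationaryP K_stab eqX eqY) dcost0 := K_stat.
  (* The compression of [D] is again a controller direction, now of order [q], where the derivative
     is known to vanish. *)
  rewrite -[RHS](dcost0 _ (ctrl_space_compress DC)).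
  exact: (sf_dcost_compresses X Y En Em Ep (pad0_dilates q q' V)
    (pad0_dilates q q' Rw) (pad1_intertwines q q' B) (pad1_intertwines q q' C)
    (pad1_intertwines q q' 0) (pad1_intertwines q q' 0) iK).
rewrite (lqg_costE Q Rw K'_stab eqX') (lqg_costE Q Rw K_stab eqX).
exact: (sf_cost_dilates X En (pad0_dilates q q' Q) (pad0_dilates q q' Rw)
  (pad1_intertwines q q' 0) iK).
Qed.
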